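(* Let $A$ be a real nonassociative algebra equipped with a norm $\|\cdot\|$ making $(A,\|\cdot\|)$ a normed space, and suppose the norm satisfies the square inequality. Let $\eta$ be any positive real number such that $\|u^{2}\|\geq \eta\|u\|^{2}$ for all $u\in A$. Then for every $c\in A$ the following holds: if for some $u\in A$ and some positive integer $n_{0}$ $$\|f_{c}^{n_{0}}(u)\|>\lambda=\max\{2\eta^{-1},\|c\|\},$$ then the orbit of $u$ under $f_c$ is unbounded.
   Context: A real nonassociative algebra is a real vector space $A$ with a bilinear multiplication (not necessarily associative, commutative or unital). All real nonassociative algebras are assumed nonzero and of dimension at least $2$ (possibly infinite-dimensional). A norm $\|\cdot\|$ on $A$ satisfies the square inequality if there is a positive real number $\eta$ such that $\|u^{2}\|\geq\eta\|u\|^{2}$ for all $u\in A$, where $u^2=u\cdot u$. For $c\in A$, $f_c:A\to A$ is the map $f_c(u)=u^2+c$; $f_c^{1}=f_c$ and $f_c^{n}(u)=f_c(f_c^{n-1}(u))$. The orbit of $u$ is $\{f_c^n(u): n \text{ a positive integer}\}$; it is bounded if there is a real $\zeta>0$ with $\|f_c^n(u)\|\leq\zeta$ for every positive integer $n$, and unbounded otherwise. *)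

(* Defs.v *)
From HB Require Import structures.
From mathcomp Require Export all_boot all_order all_algebra.
From mathcomp Require Export sesquilinear.
From mathcomp Require Export reals topology normedtype.
Set Implicit Arguments.
Unset Strict Implicit.
Unset Printing Implicit Defensive.
Export Order.TTheory GRing.Theory Num.Theory.
Export numFieldNormedType.Exports.
Local Open Scope ring_scope.

(* A nonassociative algebra on [A] is given by a product
   [mul : {bilinear A -> A -> A}]: no associativity, commutativity, unit or
   continuity is assumed, and the norm need not be submultiplicative. *)

(* [A] has two linearly independent vectors; [A] may be infinite-dimensional. *)
Definition dim_ge2 (R : realType) (A : lmodType R) : Prop :=
  exists e1 e2 : A,
    forall a b : R, a *: e1 + b *: e2 = 0 -> a = 0 /\ b = 0.

Definition square_constant (R : realType) (A : normedModType R)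
    (mul : {bilinear A -> A -> A}) (eta : R) : Prop :=
  0 < eta /\ forall u : A, `|mul u u| >= eta * `|u| ^+ 2.

Definition square_inequality (R : realType) (A : normedModType R)
    (mul : {bilinear A -> A -> A}) : Prop :=
  exists eta : R, square_constant mul eta.

Definition quad_map (R : realType) (A : normedModType R)
    (mul : {bilinear A -> A -> A}) (c u : A) : A :=
  mul u u + c.

Definition orbit_bounded (R : realType) (A : normedModType R)
    (mul : {bilinear A -> A -> A}) (c u : A) : Prop :=
  exists2 zeta : R, 0 < zeta &
    forall n : nat, (0 < n)%N -> `|iter n (quad_map mul c) u| <= zeta.

Definition orbit_unbounded (R : realType) (A : normedModType R)
    (mul : {bilinear A -> A -> A}) (c u : A) : Prop :=
  ~ orbit_bounded mul c u.

(* Main.v *)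
Require Import Defs.
From mathcomp Require Import lra.
Local Open Scope ring_scope.

(** Write [eta] for the square constant and let [x] be the norm of an orbit
    point with [x > 2 / eta] and [x > |c|].  Whenever [|w| >= x], the reverse
    triangle inequality and [|c| < |w|] give
    [|w^2 + c| >= eta |w|^2 - |c| >= (eta |w| - 1) |w|],
    and since [eta |w| - 1 >= eta x - 1 > 1] the norm strictly grows under the
    quadratic map.  The growth per step is at least the fixed amount
    [(eta x - 2) x > 0] ([quad_map_norm_growth]), so it persists along the
    orbit ([iter_quad_map_norm_growth]), and the archimedean property rules out
    any bound. *)

(** Settling for an additive gain, instead of the available geometric factor
    [eta x - 1], makes unboundedness a direct archimedean argument. *)
Lemma quad_map_norm_growth (R : realType) (A : normedModType R)
    (mul : {bilinear A -> A -> A}) (eta : R) (c w : A) (x : R) :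
  square_constant mul eta -> 2 <= eta * x -> `|c| <= x -> x <= `|w| ->
  `|w| + (eta * x - 2) * x <= `|quad_map mul c w|.
Proof.
move=> [eta_gt0 sqP] etax cx xw.
have x_ge0 : 0 <= x := le_trans (normr_ge0 c) cx.
have tri : `|mul w w| - `|c| <= `|quad_map mul c w|.
  by rewrite /quad_map -[c in X in _ <= X]opprK -(normrN c) lerB_dist.
have gain : (eta * x - 2) * x <= (eta * `|w| - 2) * `|w|.
  by apply: ler_pM; rewrite ?subr_ge0 // lerB // ler_pM2l.
have := sqP w; rewrite expr2 mulrA => sqw; lra.
Qed.

Lemma iter_quad_map_norm_growth (R : realType) (A : normedModType R)
    (mul : {bilinear A -> A -> A}) (eta : R) (c v : A) (k : nat) :
  square_constant mul eta -> 2 <= eta * `|v| -> `|c| <= `|v| ->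
  `|v| + k%:R * ((eta * `|v| - 2) * `|v|) <= `|iter k (quad_map mul c) v|.
Proof.
move=> sqP etav cv.
have gain_ge0 : 0 <= (eta * `|v| - 2) * `|v| by rewrite mulr_ge0 ?subr_ge0.
elim: k => [|k IHk]; first by rewrite mul0r addr0.
rewrite iterS -natr1 mulrDl mul1r addrA.
apply: le_trans (quad_map_norm_growth _ _ _ _ _ _ _ sqP etav cv _).
  by rewrite lerD2r.
by apply: le_trans IHk; rewrite lerDl mulr_ge0.
Qed.

Theorem theorem3p1 (R : realType) (A : normedModType R)
    (mul : {bilinear A -> A -> A})
    (hdim : dim_ge2 A)
    (hsq : square_inequality mul)
    (eta : R) (heta : square_constant mul eta)
    (c u : A) (n0 : nat) (hn0 : (0 < n0)%N)
    (hu : `|iter n0 (quad_map mul c) u| > Num.max (2 * eta^-1) `|c|) :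
  orbit_unbounded mul c u.
Proof.
case=> zeta zeta_gt0 bounded.
move: hu; rewrite gt_max; set v := iter n0 _ u => /andP[etav cv].
have eta_gt0 : 0 < eta := heta.1.
rewrite ltr_pdivrMr // mulrC in etav.
have v_gt0 : 0 < `|v| := le_lt_trans (normr_ge0 c) cv.
set d := (eta * `|v| - 2) * `|v|.
have d_gt0 : 0 < d by rewrite mulr_gt0 ?subr_gt0.
set k := Num.bound (zeta / d).
have zeta_lt : zeta < k%:R * d.
  by rewrite -ltr_pdivrMr // archi_boundP // divr_ge0 // ltW.
have := bounded (k + n0)%N (leq_trans hn0 (leq_addl _ _)).
have := iter_quad_map_norm_growth _ _ _ _ _ _ k heta (ltW etav) (ltW cv).
rewrite iterD -/v -/d; lra.
Qed.
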